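(* Fix $\alpha>0$ and $v_{0,-},v_{0,+}\in[0,1]$. For each positive integer $N$ write $\epsilon=1/N$ and consider the channel–reservoir process on $\Omega_N$ with generator $\mathbf L$ and mean densities $\rho^{\epsilon}(x,t)$, $\rho^{\epsilon}_\pm(t)$ (defined in the context). Suppose $\rho^{\epsilon}_{\pm}(0)=v_{0,\pm}$. Then for any $\alpha'>\alpha$, $r\in[0,1]$ and $t>0$, the sequences $\rho^{\epsilon}([Nr],N^{2+\alpha'}t)$, $\rho^{\epsilon}_-(N^{2+\alpha'}t)$ and $\rho^{\epsilon}_+(N^{2+\alpha'}t)$ all converge, as $N\to\infty$, to the same limit $$\frac{v_{0,-}+v_{0,+}}{2}.$$
   Context: Channel–reservoir process. For a positive integer $N$ let $\Lambda_N=\{1,\dots,N\}$ and let $M=\lfloor N^{1+\alpha}\rfloor$ be the size of each reservoir. The state space is $\Omega_N=\{0,1\}^{\Lambda_N}\times\{0,\dots,M\}\times\{0,\dots,M\}$, with elements $\omega=(\eta(1),\dots,\eta(N),n_-,n_+)$. The process is the continuous-time Markov chain with generator $$\mathbf Lf(\omega)=\tfrac12\sum_{x=1}^{N-1}[f(\omega^{x,x+1})-f(\omega)]+c_N(\omega)[f(\omega^N)-f(\omega)]+c_1(\omega)[f(\omega^1)-f(\omega)],$$ where $\omega^{x,x+1}$ is obtained from $\omega$ by exchanging $\eta(x)$ and $\eta(x+1)$; $c_N(\omega)=\tfrac12(1-\tfrac{n_+}{M})\eta(N)+\tfrac12\tfrac{n_+}{M}(1-\eta(N))$, and $\omega^N$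 is obtained from $\omega$ by replacing $(\eta(N),n_+)$ by $(0,n_++1)$ if $\eta(N)=1$ and by $(1,n_+-1)$ if $\eta(N)=0$; $c_1(\omega)=\tfrac12(1-\tfrac{n_-}{M})\eta(1)+\tfrac12\tfrac{n_-}{M}(1-\eta(1))$, and $\omega^1$ is obtained by replacing $(\eta(1),n_-)$ by $(0,n_-+1)$ if $\eta(1)=1$ and by $(1,n_--1)$ if $\eta(1)=0$. The values at time $t$ are $\eta(x,t)$, $n_\pm(t)$. The initial distribution may depend on $N$. Mean densities. Let $\mathbf E^{\epsilon}$ denote expectation for this process. Put $\eta(0,t)=n_-(t)/M$, $\eta(N+1,t)=n_+(t)/M$, and $\rho^{\epsilon}(x,t)=\mathbf E^{\epsilon}[\eta(x,t)]$ for $x\in\{0,1,\dots,N+1\}$; $\rho^{\epsilon}_-(t)=\rho^{\epsilon}(0,t)$, $\rho^{\epsilon}_+(t)=\rho^{\epsilon}(N+1,t)$. $[\cdot]$ denotes the integer part. *)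

(* Defs.v *)
From HB Require Import structures.
From mathcomp Require Import all_boot all_order all_fingroup all_algebra.
From mathcomp Require Import all_classical all_reals all_analysis.

Set Implicit Arguments.
Unset Strict Implicit.
Unset Printing Implicit Defensive.

Import Order.TTheory GRing.Theory Num.Theory.
Import numFieldNormedType.Exports.

Local Open Scope classical_set_scope.
Local Open Scope ring_scope.

(* Transition function [p t w w'] = P_w(X_t = w') on a finite state space:
   a stochastic semigroup indexed by t >= 0 whose generator, i.e. the right
   derivative at time 0 of t |-> P_t f, is the operator [L].  Nothing is
   required of [p t] for t < 0. *)
Record transition_function (R : realType) (S : finType)
    (L : (S -> R) -> S -> R) (p : R -> S -> S -> R) : Prop := {
  tf_ge0 : forall (t : R) w w', 0 <= t -> 0 <= p t w w';
  tf_sum1 : forall (t : R) w, 0 <= t -> \sum_(w' : S) p t w w' = 1;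
  tf_init : forall w w', p 0 w w' = (w == w')%:R;
  tf_semigroup : forall (s t : R) w w', 0 <= s -> 0 <= t ->
    p (s + t) w w' = \sum_(v : S) p s w v * p t v w';
  tf_generator : forall (f : S -> R) (w : S),
    (\sum_(w' : S) p h w w' * f w' - f w) / h @[h --> 0^'+] --> L f w
}.

(* Continuous-time Markov chain (X_t), t >= 0, with generator [L], on the
   probability space (T, P): right-continuous paths for the discrete topology
   of S, and the Markov property
     P(X_{t_0} = w_0, .., X_{t_k} = w_k, X_{t_k + h} = w')
       = P(X_{t_0} = w_0, .., X_{t_k} = w_k) p_h(w_k, w')
   for 0 <= t_0 <= .. <= t_k and h >= 0.  The law of X_0 is arbitrary, and
   nothing is required of [X t] for t < 0. *)
Record markov_chain (R : realType) (S : finType) (L : (S -> R) -> S -> R)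
    (d : measure_display) (T : measurableType d) (P : probability T R)
    (X : R -> T -> S) : Prop := {
  mc_measurable : forall (t : R) w, 0 <= t -> measurable [set u | X t u = w];
  mc_right_continuous : forall (t : R) u, 0 <= t ->
    \forall s \near t^'+, X s u = X t u;
  mc_markov : exists2 p : R -> S -> S -> R, transition_function L p &
    forall (k : nat) (t : 'I_k.+1 -> R) (w : 'I_k.+1 -> S) (h : R) (w' : S),
      0 <= t ord0 -> (forall i j : 'I_k.+1, (i <= j)%N -> t i <= t j) ->
      0 <= h ->
      (P ([set u | forall i, X (t i) u = w i] `&`
          [set u | X (t ord_max + h)%R u = w'])
       = P [set u | forall i, X (t i) u = w i] * (p h (w ord_max) w')%:E)%E
}.

(* Positive channel lengths are written N = n.+1.  A state is a triple
   (eta, n_-, n_+), where position i : 'I_n.+1 of eta is the site i + 1 of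
   Lambda_N = {1, .., N}. *)
Definition state (n M : nat) : finType :=
  ({ffun 'I_n.+1 -> bool} * 'I_M.+1 * 'I_M.+1)%type.

(* Meaningful for 1 <= x <= n.+1 only. *)
Definition site (n : nat) (x : nat) : 'I_n.+1 := inord x.-1.

Section Channel.
Variables (n M : nat).
Implicit Types (w : state n M) (x : nat).

Definition channel w : {ffun 'I_n.+1 -> bool} := w.1.1.
Definition nminus w : 'I_M.+1 := w.1.2.
Definition nplus w : 'I_M.+1 := w.2.

Definition eta w x : bool := channel w (site n x).

Definition exchange x w : state n M :=
  ([ffun i => channel w (tperm (site n x) (site n x.+1) i)],
   nminus w, nplus w).

Definition flip x w : {ffun 'I_n.+1 -> bool} :=
  [ffun i => if i == site n x then ~~ channel w i else channel w i].

(* New content of a reservoir holding [k] particles after an exchange with an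
   adjacent site whose occupation was [b].  The two cases that would leave
   {0, .., M} (b = true with k = M, b = false with k = 0) have rate 0 in the
   generator, so the value taken there is irrelevant. *)
Definition reservoir_update (b : bool) (k : 'I_M.+1) : 'I_M.+1 :=
  if b then inord k.+1 else inord k.-1.

Definition right_jump w : state n M :=
  (flip n.+1 w, nminus w, reservoir_update (eta w n.+1) (nplus w)).

Definition left_jump w : state n M :=
  (flip 1 w, reservoir_update (eta w 1) (nminus w), nplus w).

Variable R : realType.

Definition jump_rate (b : bool) (k : 'I_M.+1) : R :=
  2^-1 * (1 - k%:R / M%:R) * b%:R + 2^-1 * (k%:R / M%:R) * (1 - b%:R).

Definition generator (f : state n M -> R) w : R :=
  2^-1 * (\sum_(1 <= x < n.+1) (f (exchange x w) - f w))
  + jump_rate (eta w n.+1) (nplus w) * (f (right_jump w) - f w)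
  + jump_rate (eta w 1) (nminus w) * (f (left_jump w) - f w).

(* The extension of eta to {0, .., N + 1}, with N + 1 = n.+2. *)
Definition eta_ext w x : R :=
  if x == 0%N then (nminus w)%:R / M%:R
  else if x == n.+2 then (nplus w)%:R / M%:R
  else (eta w x)%:R.

Definition mean_density (d : measure_display) (T : measurableType d)
    (P : probability T R) (X : R -> T -> state n M) x (t : R) : R :=
  fine ('E_P[fun u => eta_ext (X t u) x])%E.

End Channel.

Definition reservoir_size (R : realType) (alpha : R) (N : nat) : nat :=
  Num.truncn (N%:R `^ (1 + alpha)).

(* Main.v *)
Require Import Defs.
From HB Require Import structures.
From mathcomp Require Import all_boot all_order all_fingroup all_algebra.
From mathcomp Require Import all_classical all_reals all_analysis.
From mathcomp Require Import ring lra zify.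

Set Implicit Arguments.
Unset Strict Implicit.
Unset Printing Implicit Defensive.

Import Order.TTheory GRing.Theory Num.Theory.
Import numFieldNormedType.Exports.

Local Open Scope classical_set_scope.
Local Open Scope ring_scope.

(** The mean densities solve a closed linear system.  Exchanges between
neighbouring sites act linearly on the occupation numbers, and the rates at
the two ends are tuned so that the nonlinear terms cancel: the drift of
[eta(N)] is [(n_+ / M - eta(N)) / 2] and that of [n_+] is its opposite.  Hence
[rho(x, t)], [0 <= x <= N + 1], solves the discrete heat equation on a path
whose two end points carry the large weight [M], all other sites having weight
1 (lemma [generator_eta_ext]).

Two facts about this heat equation suffice.  The weighted mass is conserved
([mass_conserved]), so the only possible equilibrium is the constant [c] equal
to the initial weighted mean.  As the [N] channel sites weigh little compared
with the reservoirs, [c] is within [N / (2 M)], of order [N^(- alpha)], of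
[(v_- + v_+) / 2], whatever the initial state of the channel.  Moreover the
weighted variance is dissipated at the rate of the Dirichlet form, which a
Poincare inequality ([poincare]) bounds below by the variance divided by
[(2 M + N) (N + 1)], a quantity of order [N^(2 + alpha)].  After the time
[N^(2 + alpha') t] the variance is thus at most [3 N^(1 + alpha)] times
[exp (- N^(alpha' - alpha) t / 6)] ([relaxation], [mean_density_relaxation],
[mean_density_cvg]).  This bound tends to 0 and dominates
the squared deviation at every site, since every weight is at least 1; the
convergence is therefore uniform over [0 <= x <= N + 1].

The time derivatives of the means are not part of the data: a transition
function comes with a right derivative at time 0 only.  The forward equation
at positive times ([is_derive_evolve]) is deduced from the semigroup property
and the contraction property of stochastic matrices. *)

(** * The forward equation of a finite-state semigroup *)

Lemma is_derive_sides (R : realType) (g : R -> R) (t l : R) :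
  (g (h + t) - g t) / h @[h --> 0^'+] --> l ->
  (g t - g (t - h)) / h @[h --> 0^'+] --> l ->
  is_derive t 1 g l.
Proof.
move=> gr gl.
have H : h^-1 *: ((g \o shift t) (h *: 1) - g t) @[h --> 0^'] --> l.
  apply: (@cvg_at_right_left_dnbhs _ R^o).
    apply: cvg_trans gr; apply: near_eq_cvg; apply: nearW => h.
    by rewrite /= [h *: 1]mulr1 [_ *: _]mulrC.
  apply/cvg_at_leftNP; rewrite oppr0.
  apply: cvg_trans gl; apply: near_eq_cvg; apply: nearW => h.
  rewrite /= [- h *: 1]mulr1 [_ *: _]mulrC invrN mulrN -mulNr opprB.
  by rewrite [- h + t]addrC.
apply: DeriveDef; first by apply/cvg_ex; exists l.
exact: cvg_lim H.
Qed.

(** The semigroup [P_t f (w) = E_w (f (X_t))]. *)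
Definition evolve (R : realType) (S : finType) (p : R -> S -> S -> R)
  (t : R) (f : S -> R) (w : S) : R := \sum_(v : S) p t w v * f v.

Section Semigroup.
Variables (R : realType) (S : finType) (L : (S -> R) -> S -> R).
Variables (p : R -> S -> S -> R) (Hp : transition_function L p).
Implicit Types (f g : S -> R) (w : S) (s t : R).

Lemma evolve0 f w : evolve p 0 f w = f w.
Proof.
rewrite /evolve (bigD1 w)//= (tf_init Hp) eqxx mul1r big1 ?addr0// => v vw.
by rewrite (tf_init Hp) eq_sym (negbTE vw) mul0r.
Qed.

Lemma evolveD s t f w : 0 <= s -> 0 <= t ->
  evolve p (s + t) f w = evolve p s (evolve p t f) w.
Proof.
move=> s0 t0; rewrite /evolve.
under eq_bigr do rewrite (tf_semigroup Hp)// mulr_suml.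
rewrite exchange_big/=; apply: eq_bigr => v _.
by rewrite mulr_sumr; apply: eq_bigr => u _; rewrite mulrA.
Qed.

Lemma evolveB t f g w :
  evolve p t (fun v => f v - g v) w = evolve p t f w - evolve p t g w.
Proof. by rewrite -sumrB; apply: eq_bigr => v _; rewrite mulrBr. Qed.

Lemma evolveZ t f a w :
  evolve p t (fun v => f v * a) w = evolve p t f w * a.
Proof. by rewrite mulr_suml; apply: eq_bigr => v _; rewrite mulrA. Qed.

Lemma transition_le1 t w v : 0 <= t -> p t w v <= 1.
Proof.
move=> t0; rewrite -(tf_sum1 Hp w t0) (bigD1 v)//= lerDl.
by apply: sumr_ge0 => u _; exact: (tf_ge0 Hp).
Qed.

Lemma normr_evolve_le t f w : 0 <= t ->
  `|evolve p t f w| <= \sum_(v : S) `|f v|.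
Proof.
move=> t0; apply: le_trans (ler_norm_sum _ _ _) _; apply: ler_sum => v _.
rewrite normrM ger0_norm ?(tf_ge0 Hp)//.
by rewrite ler_piMl// transition_le1.
Qed.

Lemma cvg_sumr_norm0 (F : set_system R) (FF : Filter F) (u : R -> S -> R) :
  (forall v, u h v @[h --> F] --> 0) ->
  \sum_(v : S) `|u h v| @[h --> F] --> 0.
Proof.
move=> u0; rewrite [X in _ --> X](_ : 0 = \sum_(v : S) `|0 : R|); last first.
  by rewrite big1// => v _; rewrite normr0.
by apply: cvg_big => [|v _]; [exact: add_continuous | exact: cvg_norm].
Qed.

Lemma evolve_init_cvg f w : evolve p h f w @[h --> 0^'+] --> f w.
Proof.
(* A convergent difference quotient times h tends to 0. *)
have H := @tf_generator _ _ _ _ Hp f w.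
have {}H : (evolve p h f w - f w) / h * h + f w @[h --> 0^'+] -->
    L f w * 0 + f w.
  apply: cvgD; last exact: cvg_cst.
  apply: cvgM; first exact: H.
  exact/cvg_at_right_filter/cvg_id.
move: H; rewrite mulr0 add0r; apply: cvg_trans; apply: near_eq_cvg; near=> h.
have h0 : h != 0 by near: h; exact: nbhs_right_neq.
by rewrite divfK// subrK.
Unshelve. all: by end_near. Qed.

(** Both one-sided difference quotients of [t |-> P_t f (w)] differ from the
expected limit by some [P_(s h) (u h)] with [u h] tending to 0.  The contraction
bound is uniform in the times [s h], which lets the left quotient be taken from
the moving time [t - h]. *)
Lemma cvg_evolve_bounded (a : R -> R) (s : R -> R) (u : R -> S -> R) (l : R) w :
  (\forall h \near 0^'+, 0 <= s h) ->
  (\forall h \near 0^'+, a h - l = evolve p (s h) (u h) w) ->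
  (forall v, u h v @[h --> 0^'+] --> 0) ->
  a h @[h --> 0^'+] --> l.
Proof.
move=> s0 aE u0.
have al0 : `|a h - l| @[h --> 0^'+] --> (0 : R).
  apply: (squeeze_cvgr _ (cvg_cst 0) (cvg_sumr_norm0 _ u0)).
  near=> h; rewrite normr_ge0/= (_ : a h - l = evolve p (s h) (u h) w).
    by apply: normr_evolve_le; near: h.
  by near: h.
by apply/subr_cvg0; exact: norm_cvg0 al0.
Unshelve. all: by end_near. Qed.

Lemma evolve_at_right t f w : 0 <= t ->
  (evolve p (h + t) f w - evolve p t f w) / h @[h --> 0^'+]
    --> evolve p t (L f) w.
Proof.
move=> t0; apply: (@cvg_evolve_bounded _ (fun=> t) (fun h v =>
  (evolve p h f v - f v) / h - L f v) _ w) => [||v].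
- exact: nearW.
- near=> h; have h0 : 0 <= h by [].
  by rewrite [h + t]addrC evolveD// evolveB evolveZ evolveB.
- by apply/subr_cvg0/(@tf_generator _ _ _ _ Hp f v).
Unshelve. all: by end_near. Qed.

(** Here [P_t f - P_(t - h) f = P_(t - h) (P_h f - f)], and the limit is written
as [P_(t - h) (P_h (L f))] so as to compare both terms under the same
[P_(t - h)]. *)
Lemma evolve_at_left t f w : 0 < t ->
  (evolve p t f w - evolve p (t - h) f w) / h @[h --> 0^'+]
    --> evolve p t (L f) w.
Proof.
move=> t0; apply: (@cvg_evolve_bounded _ (fun h => t - h) (fun h v =>
  (evolve p h f v - f v) / h - evolve p h (L f) v) _ w) => [||v].
- by near=> h; rewrite subr_ge0; near: h; exact: nbhs_right_le.
- near=> h; have h0 : 0 <= h by [].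
  have ht : 0 <= t - h by rewrite subr_ge0; near: h; exact: nbhs_right_le.
  rewrite evolveB evolveZ evolveB -!evolveD//.
  by rewrite subrK.
- rewrite -[X in _ --> X](subrr (L f v)); apply: cvgB.
    exact: (@tf_generator _ _ _ _ Hp f v).
  exact: evolve_init_cvg.
Unshelve. all: by end_near. Qed.

Lemma is_derive_evolve t f w : 0 < t ->
  is_derive t 1 (fun s => evolve p s f w) (evolve p t (L f) w).
Proof.
move=> t0; apply: is_derive_sides.
  by apply: evolve_at_right; exact: ltW.
exact: evolve_at_left.
Qed.

End Semigroup.

(** * The law of a chain at a fixed time *)

Lemma expectation_finite_range (R : realType) (d : measure_display)
    (T : measurableType d) (P : probability T R) (S : finType) (Y : T -> S)
    (f : S -> R) :
  (forall w, measurable [set u | Y u = w]) ->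
  ('E_P[fun u => f (Y u)] =
    (\sum_(w : S) fine (P [set u | Y u = w]) * f w)%R%:E)%E.
Proof.
move=> mY; rewrite unlock.
have fE u : (f (Y u))%:E =
    (\sum_(w : S) (f w)%:E * (\1_[set u | Y u = w] u)%:E)%E :> \bar R.
  rewrite (bigD1 (Y u))//= indicE mem_set// mule1 big1 ?adde0// => w /eqP wY.
  by rewrite indicE memNset ?mule0// => /esym.
under eq_integral do rewrite fE.
have mI w : P.-integrable setT (fun u => (\1_[set u | Y u = w] u)%:E).
  by apply: integrable_indic.
rewrite integral_sum//=; last first.
  by move=> w; apply: integrableZl => //; exact: mI.
rewrite -sumEFin; apply: eq_bigr => w _.
rewrite (integralZl measurableT (mI w)).
rewrite integral_indic// setIT EFinM muleC fineK//.
exact: fin_num_measure.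
Qed.

Section ChainLaw.
Variables (R : realType) (S : finType) (L : (S -> R) -> S -> R).
Variables (d : measure_display) (T : measurableType d) (P : probability T R).
Variables (X : R -> T -> S) (HX : markov_chain L P X).

(** The weights [mu] are the law of [X 0].  Computing the mean from the joint
law of [(X 0, X t)], which takes values in the finite type [S * S], reduces the
claim to the Markov property with a single conditioning time. *)
Lemma markov_chain_mean : exists2 p : R -> S -> S -> R,
  transition_function L p &
  exists2 mu : S -> R, (forall w, 0 <= mu w) /\ \sum_(w : S) mu w = 1 &
  forall (t : R) (f : S -> R), 0 <= t ->
    ('E_P[fun u => f (X t u)] = (\sum_(w : S) mu w * evolve p t f w)%R%:E)%E.
Proof.
have [p Hp pE] := mc_markov HX; exists p => //.
pose mu w := fine (P [set u | X 0 u = w]).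
have meanE t f : 0 <= t ->
    ('E_P[fun u => f (X t u)] = (\sum_(w : S) mu w * evolve p t f w)%R%:E)%E.
  move=> t0; pose Y u := (X 0 u, X t u).
  have YE w : [set u | Y u = w] =
      [set u | X 0 u = w.1] `&` [set u | X (0 + t) u = w.2].
    rewrite add0r; apply/seteqP; split=> u /=; first by move=> <-.
    by case=> e1 e2; rewrite /Y e1 e2; case: w {e1 e2}.
  have mY w : measurable [set u | Y u = w].
    rewrite YE; apply: measurableI; apply: (mc_measurable HX) => //.
    by rewrite add0r.
  rewrite (@expectation_finite_range _ _ _ P _ Y (fun w => f w.2))//.
  congr EFin; transitivity
      (\sum_(w : S) \sum_(v : S) fine (P [set u | Y u = (w, v)]) * f v).
    by rewrite pair_bigA; apply: eq_bigr => -[].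
  apply: eq_bigr => w _; rewrite mulr_sumr; apply: eq_bigr => v _.
  rewrite mulrA; congr (_ * _); rewrite YE.
  have := pE 0%N (fun=> 0) (fun=> w) t v (lexx _) (fun _ _ _ => lexx _) t0.
  have -> : [set u | forall i : 'I_1, X 0 u = w] = [set u | X 0 u = w].
    by apply/seteqP; split=> u /= => [/(_ ord0)|//].
  by move=> ->; rewrite fineM ?fin_num_measure//; apply: (mc_measurable HX).
exists mu => //; split=> [w|]; first by rewrite fine_ge0.
have := meanE 0 (fun=> 1) (lexx _).
rewrite -[fun=> 1]/(cst 1) expectation_cst => -[->].
by apply: eq_bigr => w _; rewrite (evolve0 Hp) mulr1.
Qed.

End ChainLaw.

(** * Closed equations for the mean densities *)

Definition site_weight (M K x : nat) : nat :=
  if (x == 0%N) || (x == K) then M else 1%N.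

(** Half the net flux into [x] on the path [0, .., K]; the indicators remove
the missing edge at each end point, where [x.-1] or [x.+1] has no meaning. *)
Definition laplacian (R : realType) (K : nat) (u : nat -> R) (x : nat) : R :=
  2^-1 * ((x < K)%N%:R * (u x.+1 - u x) - (0 < x)%N%:R * (u x - u x.-1)).

Section Drift.
Local Notation eta := Defs.eta.
Variables (R : realType) (n M : nat).
Hypothesis M_gt0 : (0 < M)%N.
Implicit Types (w : state n M) (x y : nat).

Let M_neq0 : M%:R != 0 :> R. Proof. by rewrite pnatr_eq0 -lt0n. Qed.

(** The terms in [b * k] of the two rates cancel.  When the reservoir is full or
empty, the transition that would leave its range has rate 0, so that the
arbitrary value of [reservoir_update] does not contribute. *)
Lemma reservoir_drift (b : bool) (k : 'I_M.+1) :
  jump_rate R b k * ((reservoir_update b k)%:R - k%:R)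
  = 2^-1 * (b%:R - k%:R / M%:R).
Proof.
rewrite /jump_rate /reservoir_update; case: b => /=.
  have [kM|] := ltnP k M.
    by rewrite inordK// -[k.+1%:R]natr1; field.
  rewrite leq_eqVlt ltnNge -ltnS ltn_ord orbF => /eqP <-.
  by rewrite divff// subrr !mulr0 mul0r add0r mul0r.
have [k0|] := posnP k; first by rewrite k0 mul0r; ring.
move: (ltn_ord k); case: (k : nat) => // j jM _ /=.
by rewrite inordK 1?ltnW// -[j.+1%:R]natr1; field.
Qed.

Lemma site_drift (b : bool) (k : 'I_M.+1) :
  jump_rate R b k * ((~~ b)%:R - b%:R) = 2^-1 * (k%:R / M%:R - b%:R).
Proof. by rewrite /jump_rate; case: b => /=; field. Qed.

Lemma site_eq x y : (0 < x <= n.+1)%N -> (0 < y <= n.+1)%N ->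
  (site n x == site n y) = (x == y).
Proof.
move=> x1 y1; rewrite -val_eqE /= !inordK; lia.
Qed.

Lemma eta_right_jump w x : (0 < x <= n.+1)%N ->
  eta (right_jump w) x = if x == n.+1 then ~~ eta w x else eta w x.
Proof. by move=> x1; rewrite /eta /channel /= ffunE site_eq ?leqnn. Qed.

Lemma eta_left_jump w x : (0 < x <= n.+1)%N ->
  eta (left_jump w) x = if x == 1%N then ~~ eta w x else eta w x.
Proof. by move=> x1; rewrite /eta /channel /= ffunE site_eq. Qed.

Lemma eta_exchange w x y : (0 < x <= n.+1)%N -> (0 < y <= n)%N ->
  eta (exchange y w) x =
  eta w (if y == x then x.+1 else if y.+1 == x then x.-1 else x).
Proof.
move=> x1 y1; rewrite /eta /channel /= ffunE.
have y2 : (0 < y <= n.+1)%N by lia.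
have y3 : (0 < y.+1 <= n.+1)%N by lia.
case: eqVneq => [->|yx]; first by rewrite tpermL.
case: eqVneq => [<-|yx1]; first by rewrite tpermR.
by rewrite tpermD// site_eq.
Qed.

(** Only the exchanges across the two edges at [x] move the content of [x]. *)
Lemma exchange_drift w x : (0 < x <= n.+1)%N ->
  \sum_(1 <= y < n.+1) ((eta (exchange y w) x)%:R - (eta w x)%:R : R)
  = (x < n.+1)%N%:R * ((eta w x.+1)%:R - (eta w x)%:R)
    - (1 < x)%N%:R * ((eta w x)%:R - (eta w x.-1)%:R).
Proof.
move=> x1.
have E y : (1 <= y < n.+1)%N ->
    (eta (exchange y w) x)%:R - (eta w x)%:R =
    (if y == x then (eta w x.+1)%:R - (eta w x)%:R else 0)
    + (if y == x.-1 then (eta w x.-1)%:R - (eta w x)%:R else 0) :> R.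
  move=> y1; rewrite eta_exchange//.
  have [->|yx] := eqVneq y x.
    by rewrite (_ : (x == x.-1) = false) ?addr0//; lia.
  have -> : (y.+1 == x) = (y == x.-1) by lia.
  by case: ifP; rewrite ?add0r ?subrr.
rewrite big_nat (eq_bigr _ E) -big_nat big_split -!big_mkcond/= !big_nat1_eq.
rewrite (_ : (1 <= x < n.+1)%N = (x < n.+1)%N); last by lia.
rewrite (_ : (1 <= x.-1 < n.+1)%N = (1 < x)%N); last by lia.
by do 2 case: ifP => _; rewrite ?mul1r ?mul0r ?addr0 ?subr0// opprB.
Qed.

(** Reservoir densities are particle numbers divided by [M], so a unit flux
changes them by [1 / M]: this is why the end points get weight [M].  At a site
next to a reservoir, the jump replaces the missing exchange with a neighbour,
also when [n = 0] and the unique site has a reservoir on both sides. *)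
Lemma generator_eta_ext w x : (x <= n.+2)%N ->
  (site_weight M n.+2 x)%:R * generator (fun w' => eta_ext R w' x) w
  = laplacian n.+2 (eta_ext R w) x.
Proof.
move=> xn; rewrite /site_weight /laplacian /generator.
have [->|x0] := eqVneq x 0%N.
  rewrite /eta_ext /= big1 ?mulr0; last by move=> y _; rewrite subrr.
  rewrite subrr mulr0 !add0r mul0r subr0 mul1r -mulrBl.
  rewrite [_ * (_ / _)]mulrA [LHS]mulrC.
  by rewrite divfK// reservoir_drift.
have [->|xn2] := eqVneq x n.+2.
  rewrite /eta_ext /= eqxx big1 ?mulr0; last first.
    by move=> y _; rewrite subrr.
  rewrite subrr mulr0 add0r addr0 ltnn mul0r sub0r mul1r -mulrBl.
  rewrite [_ * (_ / _)]mulrA [LHS]mulrC.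
  by rewrite divfK// reservoir_drift opprB (_ : (n.+1 == n.+2) = false)//; lia.
have x1 : (0 < x <= n.+1)%N by lia.
have etaE w' : eta_ext R w' x = (eta w' x)%:R.
  by rewrite /eta_ext (negbTE x0) (negbTE xn2).
rewrite /= mul1r; under eq_bigr do rewrite !etaE.
rewrite exchange_drift// !etaE eta_right_jump// eta_left_jump//.
have -> : jump_rate R (eta w n.+1) (nplus w) *
    ((if x == n.+1 then ~~ eta w x else eta w x)%:R - (eta w x)%:R) =
    2^-1 * ((x == n.+1)%:R * (eta_ext R w x.+1 - (eta w x)%:R)).
  case: eqVneq => [->|_]; last by rewrite subrr mulr0 mul0r mulr0.
  by rewrite site_drift mul1r /eta_ext /= eqxx.
have -> : jump_rate R (eta w 1) (nminus w) *
    ((if x == 1 then ~~ eta w x else eta w x)%:R - (eta w x)%:R) =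
    2^-1 * ((x == 1)%:R * (eta_ext R w x.-1 - (eta w x)%:R)).
  case: eqVneq => [->|_]; last by rewrite subrr mulr0 mul0r mulr0.
  by rewrite site_drift mul1r /eta_ext /=.
rewrite -!mulrDr; congr (_ * _).
have -> : (x < n.+2)%N by lia.
have -> : (0 < x)%N by lia.
have -> : (x < n.+1)%N%:R * ((eta w x.+1)%:R - (eta w x)%:R) =
    (x != n.+1)%:R * (eta_ext R w x.+1 - (eta w x)%:R) :> R.
  have [->|xn1] := eqVneq x n.+1; first by rewrite ltnn !mul0r.
  rewrite /eta_ext /= (_ : (x.+1 == n.+2) = false); last by lia.
  by rewrite (_ : (x < n.+1)%N); last by lia.
have -> : (1 < x)%N%:R * ((eta w x)%:R - (eta w x.-1)%:R) =
    (x != 1)%:R * ((eta w x)%:R - eta_ext R w x.-1) :> R.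
  have [->|xn1] := eqVneq x 1%N; first by rewrite !mul0r.
  rewrite /eta_ext /= (_ : (x.-1 == n.+2) = false); last by lia.
  rewrite (_ : (x.-1 == 0) = false); last by lia.
  by rewrite (_ : (1 < x)%N); last by lia.
by case: (x == n.+1); case: (x == 1) => /=; ring.
Qed.

End Drift.

(** * Relaxation of the heat equation on a weighted path *)

(** Cauchy-Schwarz against constants: the variance of [a] is nonnegative. *)
Lemma sqr_sum_le (R : realFieldType) (K : nat) (a : nat -> R) :
  (\sum_(i < K) a i) ^+ 2 <= K%:R * \sum_(i < K) a i ^+ 2.
Proof.
set S := \sum_(i < K) a i; set A := \sum_(i < K) a i ^+ 2.
have [K0|K0] := posnP K.
  by rewrite /S /A K0 !big_ord0 expr0n mul0r.
have K1 : K%:R != 0 :> R by rewrite pnatr_eq0 -lt0n.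
have : 0 <= \sum_(i < K) (a i - S / K%:R) ^+ 2.
  by apply: sumr_ge0 => i _; exact: sqr_ge0.
under eq_bigr do rewrite sqrrB -mulrnAr.
rewrite big_split sumrB/= -mulr_suml sumr_const card_ord -/S -/A => H.
rewrite -ler_pdivrMl ?ltr0n// -subr_ge0; apply: le_trans H _.
by rewrite le_eqVlt; apply/orP; left; apply/eqP; field.
Qed.

Lemma normr_increment_le (R : realFieldType) (K : nat) (u : nat -> R)
    (x y : nat) :
  (x <= K)%N -> (y <= K)%N ->
  `|u x - u y| <= \sum_(i < K) `|u i.+1 - u i|.
Proof.
wlog yx : x y / (y <= x)%N => [W xK yK|xK _].
  by case: (leqP y x) => [/W|/ltnW /W] H; [|rewrite distrC]; exact: H.
rewrite -(telescope_sumr u yx); apply: le_trans (ler_norm_sum _ _ _) _.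
rewrite -(big_mkord xpredT (fun i => `|u i.+1 - u i|)).
rewrite (big_cat_nat (leq0n y) (leq_trans yx xK))/=.
rewrite [X in _ <= _ + X](big_cat_nat yx xK)/= addrCA lerDl.
by rewrite addr_ge0// sumr_ge0.
Qed.

Lemma le_of_derive_le0 (R : realType) (F dF : R -> R) (t : R) : 0 <= t ->
  (forall s : R, 0 < s -> is_derive s 1 F (dF s)) ->
  F s @[s --> 0^'+] --> F 0 ->
  (forall s : R, 0 < s -> dF s <= 0) -> F t <= F 0.
Proof.
move=> t0 dFE F0 dF0.
have [->//|t_neq0] := eqVneq t 0.
have {t_neq0}t_gt0 : 0 < t by rewrite lt_def t_neq0.
have cF (s : R) : 0 < s -> F x @[x --> s] --> F s.
  by move=> /dFE dFs; apply/differentiable_continuous/derivable1_diffP.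
have wF : {within `[0, t], continuous F}.
  apply/continuous_within_itvP => //; split=> //.
    by move=> s; rewrite in_itv/= => /andP[s0 _]; exact: cF.
  by apply: cvg_at_left_filter; exact: cF.
apply: (ler0_derive1_le_cc _ _ wF) => //; rewrite ?in_itv/= ?lexx ?t0//.
- by move=> s; rewrite in_itv/= => /andP[/dFE].
- move=> s; rewrite in_itv/= => /andP[s0 _].
  by rewrite derive1E; have dFs := dFE _ s0; rewrite derive_val; exact: dF0.
Qed.

Lemma is_derive_sumr (R : realType) (I : finType) (h : I -> R -> R)
    (dh : I -> R) (t : R) :
  (forall i, is_derive t 1 (h i) (dh i)) ->
  is_derive t 1 (fun s => \sum_(i : I) h i s) (\sum_(i : I) dh i).
Proof.
move=> hE; rewrite [X in is_derive _ _ X _](_ : _ = \sum_(i : I) h i).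
  by elim/big_ind2 : _ => // [|*]; [exact: is_derive_cst|exact: is_deriveD].
by apply/funext => s; rewrite fct_sumE.
Qed.

Lemma laplacian_sum (R : realType) (K : nat) (I : finType) (a : I -> R)
    (u : I -> nat -> R) (x : nat) :
  laplacian K (fun y => \sum_(i : I) a i * u i y) x =
  \sum_(i : I) a i * laplacian K (u i) x.
Proof.
rewrite /laplacian -!sumrB !mulr_sumr -sumrB mulr_sumr.
by apply: eq_bigr => i _; ring.
Qed.

Section Relaxation.
Variables (R : realType) (M K : nat).
Hypothesis M_gt0 : (0 < M)%N.
Implicit Types (u v : nat -> R).

Let m x : R := (site_weight M K x)%:R.
Definition total_weight : R := \sum_(x < K.+1) (site_weight M K x)%:R.
Let W := total_weight.

Lemma site_weight_ge1 x : 1 <= m x.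
Proof. by rewrite /m ler1n /site_weight; case: ifP. Qed.

Let m_neq0 x : m x != 0.
Proof. by rewrite gt_eqF// (lt_le_trans ltr01)// site_weight_ge1. Qed.

Let m_ge0 x : 0 <= m x.
Proof. exact: ler0n. Qed.

Lemma total_weight_gt0 : 0 < W.
Proof.
rewrite /W /total_weight big_ord_recl ltr_pwDl//; first by rewrite ltr0n.
by apply: sumr_ge0 => i _.
Qed.

(** Summation by parts; there is no boundary term because [laplacian] drops
the fluxes through the ends of the path. *)
Lemma sum_mul_laplacian u v :
  \sum_(x < K.+1) v x * laplacian K u x =
  - (2^-1 * \sum_(x < K) (v x.+1 - v x) * (u x.+1 - u x)).
Proof.
rewrite /laplacian; under eq_bigr do rewrite mulrCA mulrBr.
rewrite -mulr_sumr sumrB big_ord_recr/= ltnn mul0r mulr0 addr0.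
rewrite [X in _ - X]big_ord_recl/= mul0r mulr0 add0r.
rewrite -mulrN; congr (_ * _); rewrite -sumrB -sumrN; apply: eq_bigr => i _.
by rewrite ltn_ord /bump/= add1n !mul1r; ring.
Qed.

Definition dirichlet u : R := \sum_(x < K) (u x.+1 - u x) ^+ 2.

(** A function of mean zero satisfies [W * u x = sum_y m y * (u x - u y)], so
[`|u x|] is at most the total variation of [u] along the path, whose square is
at most [K] times the Dirichlet form.  This pointwise bound is not sharp, but
gives the right order in [K] and [W] when the weight sits at the end points. *)
Lemma poincare u : \sum_(x < K.+1) m x * u x = 0 ->
  \sum_(x < K.+1) m x * u x ^+ 2 <= W * (K%:R * dirichlet u).
Proof.
move=> mu0; pose S := \sum_(i < K) `|u i.+1 - u i|.
have S0 : 0 <= S by apply: sumr_ge0.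
have uS (x : 'I_K.+1) : u x ^+ 2 <= K%:R * dirichlet u.
  have : `|u x| <= S.
    rewrite -(ler_pM2l total_weight_gt0) -{1}(gtr0_norm total_weight_gt0).
    rewrite -normrM (_ : W * u x = \sum_(y < K.+1) m y * (u x - u y)).
      rewrite /W /total_weight mulr_suml.
      apply: le_trans (ler_norm_sum _ _ _) _; apply: ler_sum => y _.
      rewrite normrM ger0_norm// ler_wpM2l//.
      by apply: normr_increment_le; rewrite -ltnS.
    under [RHS]eq_bigr do rewrite mulrBr.
    by rewrite sumrB mu0 subr0 mulr_suml.
  move=> uxS; apply: (@le_trans _ _ (S ^+ 2)).
    by rewrite -[u x ^+ 2]real_normK ?num_real// lerXn2r// nnegrE.
  apply: le_trans (sqr_sum_le _ (fun i => `|u i.+1 - u i|)) _.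
  rewrite ler_wpM2l// ler_sum// => i _.
  by rewrite real_normK ?num_real.
rewrite {1}/W /total_weight mulr_suml; apply: ler_sum => x _.
by rewrite ler_wpM2l.
Qed.

Variable g : nat -> R -> R.
Hypothesis g_derive : forall x (t : R), (x <= K)%N -> 0 < t ->
  is_derive t 1 (g x) (laplacian K (g ^~ t) x / m x).
Hypothesis g_init : forall x, (x <= K)%N -> g x s @[s --> 0^'+] --> g x 0.

Lemma cvg_ord_sum (h : nat -> R -> R) :
  (forall x, (x <= K)%N -> h x s @[s --> 0^'+] --> h x 0) ->
  \sum_(x < K.+1) h x s @[s --> 0^'+] --> \sum_(x < K.+1) h x 0.
Proof.
move=> h0; apply: cvg_big => [|x _]; first exact: add_continuous.
by apply: h0; rewrite -ltnS.
Qed.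

(** Summation by parts against the constant 1. *)
Lemma mass_conserved t : 0 <= t ->
  \sum_(x < K.+1) m x * g x t = \sum_(x < K.+1) m x * g x 0.
Proof.
move=> t0; pose F s := \sum_(x < K.+1) m x * g x s.
have dF (s : R) : 0 < s -> is_derive s 1 F 0.
  move=> s0; rewrite (_ : 0 =
      \sum_(x < K.+1) m x * (laplacian K (g ^~ s) x / m x)).
    apply: (is_derive_sumr (h := fun (x : 'I_K.+1) s => m x * g x s)) => x.
    have gx := g_derive (ltn_ord x) s0.
    exact: is_deriveZ.
  under eq_bigr do rewrite mulrC divfK// -[laplacian _ _ _]mul1r.
  rewrite (sum_mul_laplacian _ (fun=> 1)) big1 ?mulr0 ?oppr0// => x _.
  by rewrite subrr mul0r.
have F0 : F s @[s --> 0^'+] --> F 0.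
  by apply: (cvg_ord_sum (h := fun x s => m x * g x s)) => x xK;
    apply: cvgMr; exact: g_init.
apply/eqP; rewrite eq_le; apply/andP; split.
  exact: (le_of_derive_le0 (F := F) t0 dF F0).
rewrite -lerN2.
apply: (le_of_derive_le0 (F := fun s => - F s) (dF := fun=> 0)) => //.
  by move=> s s0; have dFs := dF _ s0; rewrite -oppr0; exact: is_deriveN.
exact: cvgN.
Qed.

Definition mean_initial : R := (\sum_(x < K.+1) m x * g x 0) / W.

(** Gronwall argument: the variance [V] satisfies [V' = - dirichlet], hence
[V' <= - V / (W * K)] by the Poincare inequality, and [expR (t / (W * K)) * V]
is nonincreasing.  The deviation at [x] is controlled by [V] because the weight
of [x] is at least 1, and [V 0 <= W] because the initial values and their mean
lie in [[0, 1]]. *)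
Lemma relaxation t x : (0 < K)%N -> 0 <= t -> (x <= K)%N ->
  (forall y, (y <= K)%N -> 0 <= g y 0 <= 1) ->
  (g x t - mean_initial) ^+ 2 <= W * expR (- (t / (W * K%:R))).
Proof.
move=> K0 t0 xK g01.
have W0 := total_weight_gt0; rewrite -/W in W0.
have K1 : 0 < K%:R :> R by rewrite ltr0n.
pose c := mean_initial; rewrite -/c.
pose V s := \sum_(y < K.+1) m y * (g y s - c) ^+ 2.
pose k := (W * K%:R)^-1.
have k0 : 0 < k by rewrite invr_gt0 mulr_gt0.
pose G s := expR (k * s) * V s.
have dV (s : R) : 0 < s -> is_derive s 1 V (- dirichlet (g ^~ s)).
  move=> s0; rewrite (_ : - _ = \sum_(y < K.+1)
      m y * ((g y s - c) * (laplacian K (g ^~ s) y / m y) *+ 2)).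
    apply: (is_derive_sumr (h := fun (y : 'I_K.+1) s =>
      m y * (g y s - c) ^+ 2)) => y.
    have gy := g_derive (ltn_ord y) s0.
    have gc : is_derive s 1 (fun s => g y s - c) (laplacian K (g ^~ s) y / m y).
      rewrite -[laplacian _ _ _ / _]subr0.
      exact: (is_deriveB gy (is_derive_cst c s 1)).
    have := is_deriveZ (m y) (is_deriveM gc gc); rewrite mulr2n; apply.
  rewrite (eq_bigr (fun y : 'I_K.+1 =>
      2 * ((g y s - c) * laplacian K (g ^~ s) y))).
    rewrite -mulr_sumr (sum_mul_laplacian _ (fun y => g y s - c)).
    rewrite mulrN mulVKf// /dirichlet; congr -%R; apply: eq_bigr => y _.
    by rewrite opprB addrA subrK expr2.
  by move=> y _; have := m_neq0 y; move=> my; field.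
have V_poincare s : 0 <= s -> V s <= W * (K%:R * dirichlet (g ^~ s)).
  move=> s0; have := @poincare (fun y => g y s - c).
  rewrite (_ : dirichlet _ = dirichlet (g ^~ s)).
    apply; under eq_bigr do rewrite mulrBr.
    rewrite sumrB mass_conserved// -mulr_suml -/(total_weight) -/W.
    by rewrite /c /mean_initial mulrC divfK ?subrr// gt_eqF.
  by apply: eq_bigr => y _; rewrite opprB addrA subrK.
have GV : G t <= G 0.
  apply: (le_of_derive_le0 (F := G) (dF := fun s =>
    expR (k * s) * (- dirichlet (g ^~ s)) + V s * (k * expR (k * s)))) => //.
  - move=> s s0; apply: (is_deriveM _ (dV s s0)).
    have ks : is_derive s 1 (fun s => k * s) k.
      by rewrite -[X in is_derive _ _ _ X]mulr1; exact: is_deriveZ.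
    by rewrite mulrC; exact: (is_derive1_comp (is_derive_expR (k * s)) ks).
  - apply: cvgM.
      apply: continuous_cvg; first exact: continuous_expR.
      by apply: cvgMr; apply: cvg_at_right_filter; exact: cvg_id.
    apply: (cvg_ord_sum (h := fun y s => m y * (g y s - c) ^+ 2)) => y yK.
    apply: cvgMr; rewrite !expr2; under eq_cvg do rewrite expr2.
    by apply: cvgM; (apply: cvgB; [exact: g_init|exact: cvg_cst]).
  - move=> s s0; rewrite mulrN mulrA [V s * k]mulrC [_ * expR _]mulrC.
    rewrite -mulrN -mulrDr pmulr_rle0 ?expR_gt0// addrC subr_le0.
    by rewrite ler_pdivrMl ?mulr_gt0// -mulrA; apply: V_poincare; exact: ltW.
have c01 : 0 <= c <= 1.
  rewrite /c /mean_initial divr_ge0/= ?(ltW W0)//; last first.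
    by apply: sumr_ge0 => y _; rewrite mulr_ge0// (andP (g01 _ _)).1// -ltnS.
  rewrite ler_pdivrMr// mul1r; apply: ler_sum => y _.
  by rewrite ler_piMr// (andP (g01 _ _)).2// -ltnS.
have V0 : V 0 <= W.
  apply: ler_sum => y _; rewrite ler_piMr//.
  have /andP[g0 g1] : 0 <= g y 0 <= 1 by apply: g01; rewrite -ltnS.
  case/andP: c01 => c0 c1.
  by rewrite -real_normK ?num_real// expr_le1// ler_norml; lra.
have xV : (g x t - c) ^+ 2 <= V t.
  rewrite /V (bigD1 (Ordinal (xK : (x < K.+1)%N)))//=.
  rewrite -[leLHS]addr0 lerD//; last first.
    by apply: sumr_ge0 => y _; rewrite mulr_ge0// sqr_ge0.
  by rewrite ler_peMl ?sqr_ge0// site_weight_ge1.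
apply: le_trans xV _; rewrite expRN ler_pdivlMr ?expR_gt0// mulrC.
rewrite [t / _]mulrC; apply: le_trans GV _.
by rewrite /G mulr0 expR0 mul1r.
Qed.

End Relaxation.

(** * Relaxation of the mean densities at fixed length *)

Section ChannelRelaxation.
Variables (R : realType) (n M : nat).
Hypothesis M_gt0 : (0 < M)%N.
Variables (d : measure_display) (T : measurableType d) (P : probability T R).
Variables (X : R -> T -> state n M).
Hypothesis HX : markov_chain (@generator n M R) P X.

Lemma eta_ext_01 (w : state n M) x : 0 <= eta_ext R w x <= 1.
Proof.
have k01 (k : 'I_M.+1) : 0 <= (k%:R / M%:R : R) <= 1.
  apply/andP; split; first exact: divr_ge0.
  by rewrite ler_pdivrMr ?ltr0n// mul1r ler_nat -ltnS.
rewrite /eta_ext; do 2 (case: ifP => _; first exact: k01).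
by case: Defs.eta; rewrite ?ler01 ?lexx.
Qed.

(** The constant [c] is the initial weighted mean.  The reservoirs contribute
[M] times their densities to it, and the channel an unknown amount between 0
and [n.+1], which moves the mean by at most [n.+1 / (2 * M)]. *)
Lemma mean_density_relaxation (t : R) (x : nat) : 0 <= t -> (x <= n.+2)%N ->
  exists2 c : R,
    (mean_density P X x t - c) ^+ 2 <=
      (2 * M%:R + n.+1%:R) *
        expR (- (t / ((2 * M%:R + n.+1%:R) * n.+2%:R))) &
    `|c - (mean_density P X 0 0 + mean_density P X n.+2 0) / 2| <=
      n.+1%:R / (2 * M%:R).
Proof.
move=> t0 xn.
have [p Hp [mu [mu0 mu1] muE]] := markov_chain_mean HX.
pose g y s :=
  \sum_(w : state n M) mu w * evolve p s (fun w' => eta_ext R w' y) w.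
have gE y s : 0 <= s -> mean_density P X y s = g y s.
  by move=> s0; rewrite /mean_density (muE s (fun w => eta_ext R w y)).
have g0 y : g y 0 = \sum_(w : state n M) mu w * eta_ext R w y.
  by apply: eq_bigr => w _; rewrite (evolve0 Hp).
have g01 y : 0 <= g y 0 <= 1.
  rewrite g0; apply/andP; split.
    by apply: sumr_ge0 => w _; rewrite mulr_ge0// (andP (eta_ext_01 _ _)).1.
  rewrite -mu1; apply: ler_sum => w _.
  by rewrite ler_piMr// (andP (eta_ext_01 _ _)).2.
have W_E : total_weight R M n.+2 = 2 * M%:R + n.+1%:R.
  rewrite /total_weight big_ord_recr big_ord_recl/=.
  rewrite /site_weight/= eqxx (eq_bigr (fun=> 1)); last first.
    move=> i _; rewrite /bump/= add1n.
    by rewrite (_ : (i.+1 == n.+2) = false)//; have := ltn_ord i; lia.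
  rewrite sumr_const card_ord; ring.
have g_derive y (s : R) : (y <= n.+2)%N -> 0 < s ->
    is_derive s 1 (g y) (laplacian n.+2 (g ^~ s) y / (site_weight M n.+2 y)%:R).
  move=> yn s0.
  rewrite (_ : _ / _ = \sum_(w : state n M) mu w *
      evolve p s (generator (fun w' => eta_ext R w' y)) w).
    apply: is_derive_sumr => w.
    by apply: is_deriveZ; exact: (is_derive_evolve Hp).
  have m0 : (site_weight M n.+2 y)%:R != 0 :> R.
    by rewrite gt_eqF// (lt_le_trans ltr01)// site_weight_ge1.
  rewrite laplacian_sum mulr_suml; apply: eq_bigr => w _.
  rewrite -mulrA /evolve laplacian_sum mulr_suml; congr (_ * _).
  apply: eq_bigr => v _; rewrite -mulrA -generator_eta_ext//.
  by rewrite mulrAC divff// mul1r.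
have g_init y : (y <= n.+2)%N -> g y s @[s --> 0^'+] --> g y 0.
  move=> _; rewrite g0; apply: cvg_big => [|w _]; first exact: add_continuous.
  by apply: cvgMr; exact: (evolve_init_cvg Hp).
exists (mean_initial M n.+2 g).
  have := relaxation M_gt0 g_derive g_init isT t0 xn (fun y _ => g01 y).
  by rewrite W_E gE.
rewrite !gE// /mean_initial W_E.
rewrite big_ord_recr big_ord_recl/=.
rewrite /site_weight/= eqxx (eq_bigr (fun i : 'I_n.+1 => g i.+1 0)); last first.
  move=> i _; rewrite /bump/= add1n.
  by rewrite (_ : (i.+1 == n.+2) = false) ?mul1r//; have := ltn_ord i; lia.
set S := \sum_(i < n.+1) _.
have S0 : 0 <= S by apply: sumr_ge0 => i _; rewrite (andP (g01 _)).1.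
have S1 : S <= n.+1%:R.
  rewrite -[n.+1 in leRHS]card_ord -sumr_const; apply: ler_sum => i _.
  by rewrite (andP (g01 _)).2.
have M1 : 0 < M%:R :> R by rewrite ltr0n.
have N1 : 0 < n.+1%:R :> R by rewrite ltr0n.
have /andP[a0 a1] := g01 0%N; have /andP[b0 b1] := g01 n.+2.
set a := g 0%N 0 in a0 a1 *; set b := g n.+2 0 in b0 b1 *.
move: S0 S1 M1 N1; move: (M%:R) (n.+1%:R) => /= m N S0 S1 M1 N1.
rewrite (_ : _ - _ = (S - N * (a + b) / 2) / (2 * m + N)); last first.
  by field; lra.
rewrite normrM normfV (gtr0_norm (_ : 0 < 2 * m + N)); last by lra.
apply: (@le_trans _ _ (N / (2 * m + N))).
  rewrite ler_wpM2r ?invr_ge0//; first by lra.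
  by rewrite ler_norml; apply/andP; split; nra.
by rewrite ler_pM2l// lef_pV2 ?posrE; lra.
Qed.

End ChannelRelaxation.

(** * Asymptotics in the length of the channel *)

Section Asymptotics.
Variable R : realType.
Implicit Types (a b s : R) (n : nat).

Lemma cvg_powRN a : 0 < a -> n.+1%:R `^ (- a) @[n --> \oo] --> (0 : R).
Proof.
move=> a0; have inv0 : (n.+1%:R^-1 : R) @[n --> \oo] --> 0^'+.
  move=> A A0; have : \forall n \near \oo, 0 < n.+1%:R^-1 :> R -> A n.+1%:R^-1.
    exact: cvg_harmonic A0.
  by apply: filterS => n; apply; rewrite invr_gt0.
apply: cvg_trans (cvg_comp _ _ inv0 (powR_cvg0 a0)); apply: near_eq_cvg.
apply: nearW => n /=.
by rewrite -powR_inv1// -powRrM mulN1r.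
Qed.

(** One term of the exponential series, of an order [k.+1] with
[b * k.+1 >= 1 + a], already beats [n.+1%:R `^ a] by a factor [n.+1]. *)
Lemma cvg_powR_expRN a b s : 0 < b -> 0 < s ->
  n.+1%:R `^ a * expR (- (n.+1%:R `^ b * s)) @[n --> \oo] --> (0 : R).
Proof.
move=> b0 s0; pose k := Num.truncn ((1 + a) / b).
have kb : 1 + a <= b * k.+1%:R.
  by rewrite mulrC -ler_pdivrMr// ltW// truncnS_gt.
pose C : R := k.+1`!%:R / s ^+ k.+1.
apply: (squeeze_cvgr (f := fun=> 0) (h := fun n => C * n.+1%:R^-1)).
- apply: nearW => n; have N1 : 1 <= n.+1%:R :> R by rewrite ler1n.
  move: (n.+1%:R : R) N1 => N N1; have N0 : 0 < N by lra.
  have Nneq0 : N != 0 by rewrite gt_eqF.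
  rewrite mulr_ge0 ?powR_ge0 ?expR_ge0//=.
  have y0 : 0 <= N `^ b * s by rewrite mulr_ge0 ?powR_ge0// ltW.
  have f0 : 0 < (k.+1)`!%:R :> R by rewrite ltr0n fact_gt0.
  rewrite expRN ler_pdivrMr ?expR_gt0// /C mulrAC -mulrA.
  have -> : N `^ a = N `^ (1 + a) / N.
    rewrite (powRD (r := 1)) ?Nneq0 ?implybT//.
    by rewrite powRr1 ?ltW// mulrAC divff ?mul1r.
  rewrite mulrA ler_pM2r ?invr_gt0//.
  have sk0 : 0 < s ^+ k.+1 by exact: exprn_gt0.
  have Nk : N `^ (1 + a) <= (N `^ b) ^+ k.+1.
    by rewrite -powR_mulrn ?powR_ge0// -powRrM ler_powR.
  have := expR_ge1Dxn k y0; rewrite exprMn => ek.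
  apply: (le_trans Nk); rewrite mulrAC ler_pdivlMr// -ler_pdivrMl// mulrC.
  by apply: le_trans ek; rewrite lerDr.
- exact: cvg_cst.
- by rewrite -[X in _ --> X](mulr0 C); apply: cvgMr; exact: cvg_harmonic.
Qed.

(** The factor 2 absorbs the integer part, as the reservoir is not empty. *)
Lemma reservoir_size_bounds a n : 0 < a ->
  [/\ (n.+1 <= reservoir_size a n.+1)%N,
      (reservoir_size a n.+1)%:R <= n.+1%:R `^ (1 + a) &
      n.+1%:R `^ (1 + a) <= 2 * (reservoir_size a n.+1)%:R].
Proof.
move=> a0; rewrite /reservoir_size.
have NB : n.+1%:R <= n.+1%:R `^ (1 + a) by rewrite le1r_powR ?ler1n//; lra.
have B0 : 0 <= n.+1%:R `^ (1 + a) by exact: powR_ge0.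
have NM : (n.+1 <= Num.truncn (n.+1%:R `^ (1 + a)))%N by rewrite truncn_ge_nat.
split=> //; first by rewrite truncn_le.
apply: (le_trans (ltW (truncnS_gt _))).
have : 1 <= (Num.truncn (n.+1%:R `^ (1 + a)))%:R :> R.
  by rewrite ler1n; apply: leq_trans NM.
by rewrite -natr1; lra.
Qed.

End Asymptotics.

(** Splitting the error at the weighted mean [c]: [u n] bounds the squared
distance of the density to [c], and [n.+1%:R `^ (- alpha)] the distance of [c]
to the limit.  The site [x n] is arbitrary, which covers the channel and both
reservoirs at once. *)
Lemma mean_density_cvg (R : realType) (alpha v0m v0p : R)
  (alpha_gt0 : 0 < alpha)
  (d : nat -> measure_display) (T : forall n : nat, measurableType (d n))
  (P : forall n : nat, probability (T n) R)
  (X : forall n : nat, R -> T n -> state n (reservoir_size alpha n.+1))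
  (X_chain : forall n : nat,
     markov_chain (@generator n (reservoir_size alpha n.+1) R) (P n) (X n))
  (init_minus : forall n : nat, mean_density (P n) (X n) 0 0 = v0m)
  (init_plus : forall n : nat, mean_density (P n) (X n) n.+2 0 = v0p)
  (alpha' t : R) (alpha'_gt : alpha < alpha') (t_gt0 : 0 < t)
  (x : nat -> nat) (x_le : forall n, (x n <= n.+2)%N) :
  mean_density (P n) (X n) (x n) (n.+1%:R `^ (2 + alpha') * t) @[n --> \oo]
    --> (v0m + v0p) / 2.
Proof.
pose delta := alpha' - alpha; have delta_gt0 : 0 < delta by rewrite subr_gt0.
pose u n : R := 3 * (n.+1%:R `^ (1 + alpha) *
  expR (- (n.+1%:R `^ delta * (t / 6)))).
have u_cvg : u n @[n --> \oo] --> (0 : R).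
  rewrite -(mulr0 3); apply: cvgMr; apply: cvg_powR_expRN => //; lra.
have bound_cvg : Num.sqrt (u n) + n.+1%:R `^ (- alpha) @[n --> \oo] --> (0 : R).
  rewrite -[X in _ --> X]addr0; apply: cvgD; last exact: cvg_powRN.
  rewrite -(sqrtr0 R); apply: continuous_cvg => //; exact: sqrt_continuous.
pose rho n := mean_density (P n) (X n) (x n) (n.+1%:R `^ (2 + alpha') * t).
suff rho_le n : `|rho n - (v0m + v0p) / 2| <=
    Num.sqrt (u n) + n.+1%:R `^ (- alpha).
  have rho0 : `|rho n - (v0m + v0p) / 2| @[n --> \oo] --> (0 : R).
    apply: (squeeze_cvgr _ (cvg_cst 0) bound_cvg).
    by apply: nearW => n; rewrite normr_ge0/=.
  by apply/subr_cvg0; exact: norm_cvg0 rho0.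
have [NM MB BM] := reservoir_size_bounds n alpha_gt0.
have M_gt0 : (0 < reservoir_size alpha n.+1)%N by exact: leq_trans NM.
have time_ge0 : 0 <= n.+1%:R `^ (2 + alpha') * t.
  by rewrite mulr_ge0 ?powR_ge0// ltW.
have [c] := mean_density_relaxation M_gt0 (X_chain n) time_ge0 (x_le n).
rewrite init_minus init_plus -/(rho n).
have N2 : (n.+2%:R : R) <= 2 * n.+1%:R by rewrite -natrM ler_nat; lia.
have N2_gt0 : 0 < n.+2%:R :> R by rewrite ltr0n.
have N_gt0 : 0 < n.+1%:R :> R by rewrite ltr0n.
rewrite -(ler_nat R) in NM; rewrite -(ltr_nat R) in M_gt0.
rewrite /u; move: (n.+1%:R) (n.+2%:R) N2 N2_gt0 N_gt0 NM MB BM M_gt0 => N N'.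
move: ((reservoir_size alpha n.+1)%:R) => M N2 N2_gt0 N_gt0 NM MB BM M_gt0.
have N_neq0 : N != 0 by rewrite gt_eqF.
have B_gt0 : 0 < N `^ (1 + alpha) by exact: powR_gt0.
have W_gt0 : 0 < 2 * M + N by lra.
have WB : 2 * M + N <= 3 * N `^ (1 + alpha) by lra.
move=> rho_c c_v; apply: (le_trans (ler_distD c _ _)); apply: lerD.
  rewrite -sqrtr_sqr ler_wsqrtr//; apply: (le_trans rho_c).
  rewrite mulrA ler_pM ?expR_ge0 ?(ltW W_gt0)// ler_expR lerN2.
  rewrite ler_pdivlMr ?mulr_gt0//.
  have -> : N `^ (2 + alpha') = N `^ delta * (N `^ (1 + alpha) * N).
    rewrite -[X in _ * (_ * X)]powRr1 ?ltW// -!powRD ?N_neq0 ?implybT//.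
    by congr (_ `^ _); rewrite /delta; ring.
  rewrite -[leLHS]mulrA -[leRHS]mulrA ler_pM2l ?powR_gt0//.
  (* Origin of the 6 in u: three for the total weight, two for N + 1 <= 2 N. *)
  have WK : (2 * M + N) * N' <= (3 * N `^ (1 + alpha)) * (2 * N).
    by rewrite ler_pM// ltW.
  by have := ler_wpM2l (ltW t_gt0) WK; lra.
apply: (le_trans c_v); rewrite ler_pdivrMr; last by lra.
have {1}-> : N = N `^ (- alpha) * N `^ (1 + alpha).
  by rewrite -powRD ?N_neq0 ?implybT// addrC addrK powRr1// ltW.
by rewrite ler_wpM2l ?powR_ge0.
Qed.

Theorem theorem5p1 (R : realType) (alpha v0m v0p : R)
  (alpha_gt0 : 0 < alpha)
  (v0m_01 : 0 <= v0m <= 1) (v0p_01 : 0 <= v0p <= 1)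
  (* one channel-reservoir process for each N = n.+1 *)
  (d : nat -> measure_display) (T : forall n : nat, measurableType (d n))
  (P : forall n : nat, probability (T n) R)
  (X : forall n : nat, R -> T n -> state n (reservoir_size alpha n.+1))
  (X_chain : forall n : nat,
     markov_chain (@generator n (reservoir_size alpha n.+1) R) (P n) (X n))
  (init_minus : forall n : nat, mean_density (P n) (X n) 0 0 = v0m)
  (init_plus : forall n : nat, mean_density (P n) (X n) n.+2 0 = v0p)
  (alpha' r t : R) (alpha'_gt : alpha < alpha') (r_01 : 0 <= r <= 1)
  (t_gt0 : 0 < t) :
  [/\ mean_density (P n) (X n) (Num.truncn (n.+1%:R * r))
        (n.+1%:R `^ (2 + alpha') * t) @[n --> \oo] --> (v0m + v0p) / 2,
      mean_density (P n) (X n) 0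
        (n.+1%:R `^ (2 + alpha') * t) @[n --> \oo] --> (v0m + v0p) / 2 &
      mean_density (P n) (X n) n.+2
        (n.+1%:R `^ (2 + alpha') * t) @[n --> \oo] --> (v0m + v0p) / 2].
Proof.
have Nr n : (Num.truncn (n.+1%:R * r) <= n.+2)%N.
  case/andP: r_01 => r0 r1; apply: (@leq_trans n.+1) => //.
  have : n.+1%:R * r <= n.+1%:R by rewrite ler_piMr.
  by move=> /le_truncn; rewrite natrK.
split; apply: (mean_density_cvg alpha_gt0 X_chain init_minus init_plus) => //.
Qed.
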